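(* Let $v=x_1\ldots x_{n-1}$ ($n\ge1$) be a word over $\{0,1\}$. The group $\mathfrak{K}(v)$ is torsion free.
   Context: Automorphisms of the binary rooted tree $\{0,1\}^*$ act on the right. $\langle\langle g_0,g_1\rangle\rangle$ denotes the automorphism $0u\mapsto0u^{g_0}$, $1u\mapsto1u^{g_1}$; $\sigma$ exchanges $0$ and $1$ in the first letter; $\langle\langle g_0,g_1\rangle\rangle\sigma$ means first apply $\langle\langle g_0,g_1\rangle\rangle$, then $\sigma$. For $v=x_1\ldots x_{n-1}$, $\mathfrak{K}(v)$ is the subgroup of $\mathrm{Aut}(\{0,1\}^* )$ generated by $a_1,\dots,a_n$ defined recursively by $a_1=\langle\langle1,a_n\rangle\rangle\sigma$ and, for $1\le i<n$, $a_{i+1}=\langle\langle a_i,1\rangle\rangle$ if $x_i=0$, $a_{i+1}=\langle\langle1,a_i\rangle\rangle$ if $x_i=1$. *)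

(* Defs.v *)
(* MathComp with mathcomp-classical: the groupType structure needs a choiceType,
   which boolp supplies for the uncountable type of tree automorphisms. *)
From HB Require Import structures.
From mathcomp Require Import all_boot.
From mathcomp Require Import boolp classical_sets.

Set Implicit Arguments.
Unset Strict Implicit.
Unset Printing Implicit Defensive.

Local Open Scope group_scope.

(** The binary rooted tree: its vertices are the words over {0,1} ([false] is
    the letter 0 and [true] the letter 1), its root is the empty word. *)

Definition tree_adj (u w : seq bool) : bool :=
  [exists b : bool, (w == rcons u b) || (u == rcons w b)].

Record treeAut := TreeAut {
  taut :> seq bool -> seq bool;
  taut_inv : seq bool -> seq bool;
  tautK : cancel taut taut_inv;
  tautVK : cancel taut_inv taut;
  taut_root : taut [::] = [::];
  taut_adj : forall u w, tree_adj (taut u) (taut w) = tree_adj u w }.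

Lemma tautP (g h : treeAut) : (forall u, g u = h u) -> g = h.
Proof.
case: g => g g' gK gVK g0 gA; case: h => h h' hK hVK h0 hA /= /funext eq_gh.
case: _ / eq_gh hK hVK h0 hA => hK hVK h0 hA.
have eq' : g' = h' by apply/funext => u; rewrite -{1}(hVK u) gK.
case: _ / eq' hK hVK => hK hVK.
by congr TreeAut; apply: Prop_irrelevance.
Qed.

Lemma tree_adj0 b w : tree_adj [::] (b :: w) = (w == [::]).
Proof.
apply/existsP/eqP => [[c /orP[/eqP[_ ->] //|/eqP]] | ->].
  by move/(congr1 size); rewrite size_rcons.
by exists b; rewrite eqxx.
Qed.

Lemma tree_adjC u w : tree_adj u w = tree_adj w u.
Proof. by apply: eq_existsb => b; rewrite orbC. Qed.

Lemma tree_adj_cons b c u w :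
  tree_adj (b :: u) (c :: w) = (b == c) && tree_adj u w.
Proof.
apply/existsP/andP => [[d] | [/eqP-> /existsP[d H]]].
  by case/orP=> /eqP[-> ->]; rewrite eqxx; split=> //;
    apply/existsP; exists d; rewrite eqxx ?orbT.
by exists d; rewrite !rcons_cons !eqseq_cons !eqxx.
Qed.

(** Group structure; automorphisms act on the right, so that in a product the
    left factor is applied first. *)

Definition taut_one : treeAut :=
  @TreeAut id id (fun=> erefl) (fun=> erefl) erefl (fun _ _ => erefl).

Fact taut_mul_root (g h : treeAut) : (h \o g) [::] = [::].
Proof. by rewrite /= !taut_root. Qed.
Fact taut_mul_adj (g h : treeAut) u w :
  tree_adj ((h \o g) u) ((h \o g) w) = tree_adj u w.
Proof. by rewrite /= !taut_adj. Qed.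
Definition taut_mul (g h : treeAut) : treeAut :=
  TreeAut (can_comp (@tautK h) (@tautK g)) (can_comp (@tautVK g) (@tautVK h))
    (taut_mul_root g h) (taut_mul_adj g h).

Fact taut_invg_root (g : treeAut) : taut_inv g [::] = [::].
Proof. by rewrite -{1}(taut_root g) tautK. Qed.
Fact taut_invg_adj (g : treeAut) u w :
  tree_adj (taut_inv g u) (taut_inv g w) = tree_adj u w.
Proof. by rewrite -(taut_adj g) !tautVK. Qed.
Definition taut_invg (g : treeAut) : treeAut :=
  TreeAut (@tautVK g) (@tautK g) (taut_invg_root g) (taut_invg_adj g).

HB.instance Definition _ := gen_eqMixin treeAut.
HB.instance Definition _ := gen_choiceMixin treeAut.

Fact taut_mulA : associative taut_mul. Proof. by move=> *; apply: tautP. Qed.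
Fact taut_mul1 : left_id taut_one taut_mul.
Proof. by move=> *; apply: tautP. Qed.
Fact taut_mulr1 : right_id taut_one taut_mul.
Proof. by move=> *; apply: tautP. Qed.
Fact taut_mulV : left_inverse taut_one taut_invg taut_mul.
Proof. by move=> g; apply: tautP => u /=; rewrite tautVK. Qed.
Fact taut_mulrV : right_inverse taut_one taut_invg taut_mul.
Proof. by move=> g; apply: tautP => u /=; rewrite tautK. Qed.

HB.instance Definition _ := isGroup.Build treeAut
  taut_mulA taut_mul1 taut_mulr1 taut_mulV taut_mulrV.

Lemma taut1E u : (1 : treeAut) u = u. Proof. by []. Qed.
Lemma tautME (g h : treeAut) u : (g * h) u = h (g u). Proof. by []. Qed.

(** [taut_pair g0 g1] is <<g0, g1>>: 0u |-> 0(u^g0), 1u |-> 1(u^g1). *)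

Definition pair_fun (f0 f1 : seq bool -> seq bool) (u : seq bool) : seq bool :=
  if u is b :: u' then b :: (if b then f1 u' else f0 u') else [::].

Fact pair_funK (g0 g1 : treeAut) :
  cancel (pair_fun g0 g1) (pair_fun (taut_inv g0) (taut_inv g1)).
Proof. by case=> //= -[] u; rewrite tautK. Qed.
Fact pair_funVK (g0 g1 : treeAut) :
  cancel (pair_fun (taut_inv g0) (taut_inv g1)) (pair_fun g0 g1).
Proof. by case=> //= -[] u; rewrite tautVK. Qed.
Fact pair_fun_adj (g0 g1 : treeAut) u w :
  tree_adj (pair_fun g0 g1 u) (pair_fun g0 g1 w) = tree_adj u w.
Proof.
have root_eq (g : treeAut) x : (g x == [::]) = (x == [::]).
  by rewrite -{1}(taut_root g) (can_eq (@tautK g)).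
case: u w => [|b u] [|c w] //=.
- by rewrite !tree_adj0; case: c; rewrite root_eq.
- by rewrite tree_adjC [RHS]tree_adjC !tree_adj0; case: b; rewrite root_eq.
- by rewrite !tree_adj_cons; case: b; case: c => //=; rewrite taut_adj.
Qed.
Definition taut_pair (g0 g1 : treeAut) : treeAut :=
  TreeAut (pair_funK g0 g1) (pair_funVK g0 g1) erefl (pair_fun_adj g0 g1).

Definition swap_fun (u : seq bool) : seq bool :=
  if u is b :: u' then ~~ b :: u' else [::].

Fact swap_funK : involutive swap_fun.
Proof. by case=> //= b u; rewrite negbK. Qed.
Fact swap_fun_adj u w : tree_adj (swap_fun u) (swap_fun w) = tree_adj u w.
Proof.
case: u w => [|b u] [|c w] //=; rewrite ?tree_adj_cons ?tree_adj0 //.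
- by rewrite tree_adjC [RHS]tree_adjC !tree_adj0.
- by rewrite (inj_eq negb_inj).
Qed.
Definition taut_sigma : treeAut :=
  TreeAut swap_funK swap_funK erefl swap_fun_adj.

(** The generators of K(v).  With v = x_1 ... x_(n-1), n = (size v).+1 and
    x_(i+1) is [nth false v i]; [knead v i] is a_(i+1), so the generators
    a_1, ..., a_n are the [knead v i] with i <= size v.  The action is given by
    recursion on the word; [knead0], [kneadS] recover the defining equations
    in the group, and [knead_unique] shows that these determine it. *)

Fixpoint knead_fun (v : seq bool) (i : nat) (w : seq bool) : seq bool :=
  match w, i with
  | [::], _ => [::]
  | b :: u, 0 => ~~ b :: (if b then knead_fun v (size v) u else u)
  | b :: u, j.+1 => b :: (if b == nth false v j then knead_fun v j u else u)
  end.

Fixpoint knead_inv (v : seq bool) (i : nat) (w : seq bool) : seq bool :=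
  match w, i with
  | [::], _ => [::]
  | b :: u, 0 => ~~ b :: (if b then u else knead_inv v (size v) u)
  | b :: u, j.+1 => b :: (if b == nth false v j then knead_inv v j u else u)
  end.

Fact knead_funK v i : cancel (knead_fun v i) (knead_inv v i).
Proof.
move=> u; elim: u i => [|b u IHu] [|i] //=; first by case: b; rewrite ?IHu.
by case: (b == _) => //; rewrite IHu.
Qed.
Fact knead_funVK v i : cancel (knead_inv v i) (knead_fun v i).
Proof.
move=> u; elim: u i => [|b u IHu] [|i] //=; first by case: b; rewrite ?IHu.
by case: (b == _) => //; rewrite IHu.
Qed.
Fact knead_fun_root v i : knead_fun v i [::] = [::].
Proof. by case: i. Qed.
Fact knead_fun_adj v i u w :
  tree_adj (knead_fun v i u) (knead_fun v i w) = tree_adj u w.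
Proof.
have root_eq j x : (knead_fun v j x == [::]) = (x == [::]).
  by rewrite -{1}(knead_fun_root v j) (can_eq (@knead_funK v j)).
elim: u i w => [|b u IHu] i [|c w]; rewrite ?knead_fun_root //.
- by case: i => [|i]; rewrite /= !tree_adj0; case: ifP.
- rewrite tree_adjC [RHS]tree_adjC.
  by case: i => [|i]; rewrite /= !tree_adj0; case: ifP.
case: i => [|i]; rewrite /= !tree_adj_cons ?(inj_eq negb_inj).
  by case: eqP => //= ->; case: ifP.
by case: eqP => //= ->; case: ifP.
Qed.
Definition knead (v : seq bool) (i : nat) : treeAut :=
  TreeAut (@knead_funK v i) (@knead_funVK v i)
    (knead_fun_root v i) (@knead_fun_adj v i).

Lemma knead0 v : knead v 0 = taut_pair 1 (knead v (size v)) * taut_sigma.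
Proof. by apply: tautP => -[|[] u]. Qed.

Lemma kneadS v i : knead v i.+1 =
  if nth false v i then taut_pair 1 (knead v i) else taut_pair (knead v i) 1.
Proof. by apply: tautP => -[|[] u] /=; case: nth. Qed.

Lemma knead_unique v (a : nat -> treeAut) :
    a 0 = taut_pair 1 (a (size v)) * taut_sigma ->
    (forall i, i < size v -> a i.+1 =
      if nth false v i then taut_pair 1 (a i) else taut_pair (a i) 1) ->
  forall i, i <= size v -> a i = knead v i.
Proof.
move=> a0 aS i lei; apply: tautP => u; elim: u i lei => [|b u IHu] [|i] lei.
- by rewrite !taut_root.
- by rewrite !taut_root.
- by rewrite a0 knead0; case: b; rewrite /= ?IHu.
- rewrite aS // kneadS; case: nth; case: b => //=.
    by rewrite IHu // ltnW.
  by rewrite IHu // ltnW.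
Qed.

Local Open Scope classical_set_scope.

Definition generated_subgroup (G : groupType) (S : set G) : set G :=
  smallest [set H : set G | group_closed (mem H)] S.

Definition torsion_free (G : groupType) (H : set G) : Prop :=
  forall g : G, H g -> forall m : nat, (0 < m)%N -> g ^+ m = 1 -> g = 1.

Definition kneading_group (v : seq bool) : set treeAut :=
  generated_subgroup [set knead v i | i in [set i | (i <= size v)%N]].

(* Main.v *)
Require Import Defs.
From mathcomp Require Import all_boot.
From mathcomp Require Import boolp classical_sets.
From mathcomp Require Import zify.

(** An element of the kneading group is given by a word in the letters
    [a_i] and [a_i^-1].  The idea is that the exponent sum of a word in each
    generator depends only on the group element ([relator_balanced]), so that
    the group maps to a free abelian group; an element [g] of finite order is
    in the kernel.  In particular its exponent sum in [a_1] is zero, hence the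
    number of its letters [a_1] and [a_1^-1] is even, and [g] fixes both letters
    0 and 1.  Write [g = <<g_0, g_1>>].  The states [g_0] and [g_1] belong to the
    group again and have finite order, so the same argument applies to them,
    and so on down the tree: [g] fixes every vertex ([torsion_word_acts_trivially]).

    Exponent sums are well defined because of the way in which the recursion
    distributes letters.  Rewriting a word [w] to words for its states, each
    letter of [w] yields exactly one letter, of the same sign, in exactly one of
    the two states: [a_(i+1)] yields [a_i], and [a_1] yields [a_n]
    ([occ_sections_next], [occ_sections_first]).  Hence the lengths of the two
    states add up to that of [w], and the exponent sums of [w] are obtained
    from those of the states by a cyclic shift.  If [w] is a relator, then so
    are its states.  If both are shorter than [w], induction applies.  Otherwise
    one of them is empty, which forces the occurrences of [a_1] and [a_1^-1] in
    [w] to alternate in sign ([occ_first_alternate]); being even in number they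
    cancel, so the exponent sum in [a_1] is zero.  The other generators follow by
    the shift.

    A statement that an exponent sum vanishes is expressed as the equality of
    the numbers of positive and negative letters. *)

Set Implicit Arguments.
Unset Strict Implicit.
Unset Printing Implicit Defensive.

Local Open Scope group_scope.

(** * Words in the generators and their states *)

(** The index starts at 0: [(i, false)] encodes [a_(i+1)], and [(i, true)] its
    inverse. *)
Definition letter := (nat * bool)%type.

Definition letter_aut (v : seq bool) (l : letter) : treeAut :=
  if l.2 then (knead v l.1)^-1 else knead v l.1.

Definition word_aut (v : seq bool) (w : seq letter) : treeAut :=
  \prod_(l <- w) letter_aut v l.

(** Beyond index [size v] the function [knead v] still has values, but they are
    not generators and would spoil the cyclic shift of the indices. *)
Definition wf_word (v : seq bool) (w : seq letter) : bool :=
  all (fun l : letter => l.1 <= size v) w.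

(** For the first generator the two signs differ in the subtree where the
    nontrivial state sits: [a_1 = <<1, a_n>> sigma], whereas
    [a_1^-1 = <<a_n^-1, 1>> sigma]. *)
Definition letter_section (v : seq bool) (b : bool) (l : letter) : seq letter :=
  match l.1 with
  | 0 => if b != l.2 then [:: (size v, l.2)] else [::]
  | j.+1 => if b == nth false v j then [:: (j, l.2)] else [::]
  end.

Definition swaps (l : letter) : bool := if l.1 is 0 then true else false.

Fixpoint word_section (v : seq bool) (b : bool) (w : seq letter) : seq letter :=
  if w is l :: w' then
    letter_section v b l ++ word_section v (b (+) swaps l) w'
  else [::].

Definition word_swaps (w : seq letter) : bool := odd (count swaps w).

Definition occ (j : nat) (e : bool) (w : seq letter) : nat :=
  count_mem (j, e) w.

Lemma word_aut_cons v l w : word_aut v (l :: w) = letter_aut v l * word_aut v w.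
Proof. exact: big_cons. Qed.

Lemma word_aut_cat v w1 w2 :
  word_aut v (w1 ++ w2) = word_aut v w1 * word_aut v w2.
Proof. exact: big_cat. Qed.

Lemma word_aut_nseq v w m :
  word_aut v (flatten (nseq m w)) = word_aut v w ^+ m.
Proof.
elim: m => [|m IHm] /=; first exact: big_nil.
by rewrite word_aut_cat IHm expgS.
Qed.

Lemma letter_aut_cons v l b u :
  letter_aut v l (b :: u) =
    (b (+) swaps l) :: word_aut v (letter_section v b l) u.
Proof.
have word_aut1 k : word_aut v [:: k] = letter_aut v k by exact: big_seq1.
have word_aut0 : word_aut v [::] = 1 by exact: big_nil.
case: l => [[|j] [|]]; rewrite /letter_aut /letter_section /swaps /=.
- by case: b; rewrite /= ?word_aut1 ?word_aut0.
- by case: b; rewrite /= ?word_aut1 ?word_aut0.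
- by rewrite addbF; case: eqP => _; rewrite ?word_aut1 ?word_aut0.
- by rewrite addbF; case: eqP => _; rewrite ?word_aut1 ?word_aut0.
Qed.

(** The wreath recursion carried out on words. *)
Lemma word_aut_consE v w b u :
  word_aut v w (b :: u) =
    (b (+) word_swaps w) :: word_aut v (word_section v b w) u.
Proof.
elim: w b u => [|l w IHw] b u; first by rewrite /word_aut !big_nil addbF.
rewrite word_aut_cons tautME letter_aut_cons IHw word_aut_cat tautME.
by rewrite /word_swaps /= oddD oddb addbA.
Qed.

Lemma wf_word_cat v w1 w2 :
  wf_word v (w1 ++ w2) = wf_word v w1 && wf_word v w2.
Proof. exact: all_cat. Qed.

Lemma wf_section v b w : wf_word v w -> wf_word v (word_section v b w).
Proof.
elim: w b => //= -[i e] w IHw b /andP[/= lei wf_w].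
rewrite wf_word_cat IHw // andbT /letter_section.
case: i lei => [|j] ltj /=; case: ifP => //= _.
  by rewrite leqnn.
by rewrite ltnW.
Qed.

Lemma section_cat v b w1 w2 : word_section v b (w1 ++ w2) =
  word_section v b w1 ++ word_section v (b (+) word_swaps w1) w2.
Proof.
elim: w1 b => [|l w1 IHw] b /=; first by rewrite addbF.
by rewrite IHw catA /word_swaps /= oddD oddb addbA.
Qed.

(** An automorphism that fixes 0 and 1 is the pair of its states, so its powers
    are computed state by state. *)
Lemma section_nseq v b w m : word_swaps w = false ->
  word_section v b (flatten (nseq m w)) =
    flatten (nseq m (word_section v b w)).
Proof.
by move=> sw; elim: m => //= m IHm; rewrite section_cat sw addbF IHm.
Qed.

(** * Distribution of the letters over the two states *)

Lemma size_sections v w :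
  size (word_section v false w) + size (word_section v true w) = size w.
Proof.
elim: w => //= -[i e] w IHw; rewrite -IHw !size_cat.
rewrite /letter_section /swaps; case: i => [|j] /=.
  by case: e => /=; lia.
by case: (nth _ _ _) => /=; lia.
Qed.

Lemma occ_sections_next v j e w : j < size v -> wf_word v w ->
  occ j e (word_section v false w) + occ j e (word_section v true w)
  = occ j.+1 e w.
Proof.
rewrite /occ => ltj; elim: w => //= -[i d] w IHw /andP[/= lei /IHw <-].
rewrite !count_cat /letter_section /swaps; case: i lei => [|i] lei /=.
  by case: d => /=; rewrite !xpair_eqE /=;
    case: (size v =P j) ltj => [->|_] /=; lia.
rewrite xpair_eqE eqSS -xpair_eqE.
by case: (nth _ _ _) => /=; lia.
Qed.

Lemma occ_sections_first v e w : wf_word v w ->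
  occ (size v) e (word_section v false w) +
    occ (size v) e (word_section v true w)
  = occ 0 e w.
Proof.
rewrite /occ; elim: w => //= -[i d] w IHw /andP[/= lei /IHw <-].
rewrite !count_cat /letter_section /swaps; case: i lei => [|i] lei /=.
  by case: d => /=; rewrite !xpair_eqE eqxx /=; lia.
by case: (nth _ _ _) => /=; rewrite !xpair_eqE; case: eqP lei => [->|_] /=; lia.
Qed.

Lemma count_swaps w : count swaps w = occ 0 false w + occ 0 true w.
Proof.
rewrite /occ; elim: w => //= -[i d] w ->.
by rewrite /swaps !xpair_eqE; case: i => [|i]; case: d => /=; lia.
Qed.

(** With the sign [e] of a letter [(0, e)] read as a letter of the tree, such an
    occurrence leaves no trace in the state only if [e] is the current image of
    [b]; as it flips that image, the next occurrence must have the opposite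
    sign.  The first one has sign [b], so the alternating sequence contains one
    [b] too many exactly if its length is odd. *)
Lemma occ_first_alternate v b w : word_section v b w = [::] ->
  occ 0 b w = occ 0 (~~ b) w + word_swaps w.
Proof.
rewrite /word_swaps /occ; elim: w b => //= -[i d] w IHw b.
rewrite /letter_section /swaps; case: i => [|j] /=.
  case: (eqVneq b d) => //= <- /IHw; rewrite addbT negbK !xpair_eqE eqxx => ->.
  by case: (odd _); case: b => /=; lia.
by case: (_ == _) => //=; rewrite addbF => /IHw ->.
Qed.

(** * Exponent sums *)

Lemma relator_no_swap v w : word_aut v w = 1 -> word_swaps w = false.
Proof.
by move=> w1; have := word_aut_consE v w false [::]; rewrite w1 => -[].
Qed.

Lemma relator_section v b w :
  word_aut v w = 1 -> word_aut v (word_section v b w) = 1.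
Proof.
move=> w1; apply: tautP => u.
by have := word_aut_consE v w b u; rewrite w1 => -[_ <-].
Qed.

(** This makes exponent sums well defined on the group.  The induction is on the
    length of the word, then on the generator: going from [a_(j+1)] to [a_j]
    need not shorten the word, but going from [a_1] to [a_n] does, unless a
    state is empty, and then the alternation of signs concludes. *)
Lemma relator_balanced v w j : wf_word v w -> word_aut v w = 1 ->
  j <= size v -> occ j false w = occ j true w.
Proof.
have [n] := ubnP (size w); elim: n w j => // n IHn w j.
elim: j w => [|j IHj] w lt_wn wf_w w1 lej; last first.
  have le_sec b : size (word_section v b w) <= size w.
    by rewrite -(size_sections v w); case: b; lia.
  rewrite -!(occ_sections_next _ lej wf_w).
  by congr (_ + _)%N; apply: IHj;
    rewrite ?relator_section ?wf_section ?(ltnW lej) //;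
    apply: leq_ltn_trans lt_wn.
have sw := relator_no_swap w1; have szE := size_sections v w.
have [s0|s0] := posnP (size (word_section v false w)).
  by have := occ_first_alternate (size0nil s0); rewrite sw addn0.
have [s1|s1] := posnP (size (word_section v true w)).
  by have := occ_first_alternate (size0nil s1); rewrite sw addn0 => ->.
rewrite -!(occ_sections_first _ wf_w).
by congr (_ + _)%N; apply: IHn; rewrite ?relator_section ?wf_section //; lia.
Qed.

Lemma wf_nseq v w m : wf_word v w -> wf_word v (flatten (nseq m w)).
Proof. by move=> wf_w; elim: m => //= m IHm; rewrite wf_word_cat wf_w. Qed.

Lemma occ_nseq j e w m : occ j e (flatten (nseq m w)) = (m * occ j e w)%N.
Proof. elim: m => //= m IHm; rewrite mulSn -IHm; exact: count_cat. Qed.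

(** * Torsion *)

Lemma torsion_word_no_swap v w m : 0 < m -> wf_word v w ->
  word_aut v w ^+ m = 1 -> word_swaps w = false.
Proof.
move=> m_gt0 wf_w wm1; rewrite -word_aut_nseq in wm1.
have := relator_balanced (wf_nseq m wf_w) wm1 (leq0n _).
rewrite !occ_nseq => /eqP; rewrite eqn_pmul2l // => /eqP eq_occ.
by rewrite /word_swaps count_swaps eq_occ addnn odd_double.
Qed.

Lemma torsion_word_acts_trivially v w m u : 0 < m -> wf_word v w ->
  word_aut v w ^+ m = 1 -> word_aut v w u = u.
Proof.
move=> m_gt0; elim: u w => [|b u IHu] w wf_w wm1; first by rewrite taut_root.
have sw := torsion_word_no_swap m_gt0 wf_w wm1.
rewrite word_aut_consE sw addbF IHu ?wf_section //.
by rewrite -word_aut_nseq -section_nseq // relator_section // word_aut_nseq.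
Qed.

Lemma word_aut_inv v w : wf_word v w ->
  exists2 w', wf_word v w' & word_aut v w' = (word_aut v w)^-1.
Proof.
elim: w => [|[i e] w IHw] /=.
  by exists [::]; rewrite // /word_aut big_nil invg1.
case/andP=> lei /IHw[w' wf_w' w'E]; exists (w' ++ [:: (i, ~~ e)]).
  by rewrite wf_word_cat wf_w' /= lei.
rewrite word_aut_cat w'E word_aut_cons invgM /word_aut big_seq1 /letter_aut /=.
by case: e => //=; rewrite invgK.
Qed.

Lemma kneading_group_word v g : kneading_group v g ->
  exists2 w, wf_word v w & word_aut v w = g.
Proof.
apply: (@smallest_sub _ _ _
  [set h | exists2 w, wf_word v w & word_aut v w = h]%classic).
  split; first by rewrite inE; exists [::]; rewrite // /word_aut big_nil.
  move=> g1 g2; rewrite !inE.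
  move=> -[w1 wf1 <-] [w2 /word_aut_inv[w' wf' w'E] <-]; exists (w1 ++ w').
    by rewrite wf_word_cat wf1.
  by rewrite word_aut_cat w'E.
move=> _ [i lei <-]; exists [:: (i, false)]; first by rewrite /= andbT.
by rewrite /word_aut big_seq1.
Qed.

Theorem proposition3p11 (v : seq bool) : torsion_free (kneading_group v).
Proof.
move=> g /kneading_group_word[w wf_w <-] m m_gt0 wm1.
by apply: tautP => u; apply: torsion_word_acts_trivially wm1.
Qed.
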